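(* Let $T_n(q)=\sum_{\lambda\vdash n}q^{\mathrm{bump}(\lambda)}$, the sum being over all partitions $\lambda$ of $n$. Then $$T_n(q)=[t^n]\ \prod_{i=1}^{n}\frac{1}{1-q^{\binom{i}{2}}t^i}.$$
   Context: For a partition $\lambda=(\lambda_1,\lambda_2,\ldots)$ (weakly decreasing parts), $\mathrm{bump}(\lambda)=\sum_{i\ge1}(i-1)\lambda_i$; this is the number of bumps in the Robinson–Schensted procedure applied to any permutation whose tableaux have shape $\lambda$. $[t^n]F$ denotes the coefficient of $t^n$ in the formal power series $F$ in $t$ (with coefficients polynomials in $q$). *)

(* Defs.v *)
From HB Require Import structures.
From mathcomp Require Import all_boot all_order all_algebra.
From mathcomp Require Import boolp.

Set Implicit Arguments.
Unset Strict Implicit.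
Unset Printing Implicit Defensive.

Import GRing.Theory.

Local Open Scope nat_scope.

Definition is_intpart (n : nat) (s : seq nat) : bool :=
  [&& sorted geq s, 0 \notin s & sumn s == n].

Record intpart (n : nat) := IntPart {
  parts :> seq nat;
  partsP : is_intpart n parts
}.

HB.instance Definition _ n := [isSub for @parts n].
HB.instance Definition _ n := [Countable of intpart n by <:].

(* Finiteness: a partition of n, padded with zeros, is an n-tuple over 'I_n.+1. *)
Section IntPartFinite.

Variable n : nat.

Definition intpart_pad (la : intpart n) : n.-tuple 'I_n.+1 :=
  [tuple inord (nth 0 la i) | i < n].

Definition intpart_unpad (t : n.-tuple 'I_n.+1) : option (intpart n) :=
  insub [seq k <- map val t | k != 0].

Lemma size_le_sumn (s : seq nat) : 0 \notin s -> size s <= sumn s.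
Proof.
elim: s => //= x s IHs; rewrite inE negb_or eq_sym -lt0n => /andP[x0 /IHs].
by rewrite -add1n; apply: leq_add.
Qed.

Lemma nth_le_sumn (s : seq nat) i : nth 0 s i <= sumn s.
Proof.
elim: s i => [|x s IHs] [|i] //=; first exact: leq_addr.
exact: leq_trans (IHs i) (leq_addl _ _).
Qed.

Lemma intpart_padK : pcancel intpart_pad intpart_unpad.
Proof.
move=> la; rewrite /intpart_unpad.
suff -> : [seq k <- map val (intpart_pad la) | k != 0] = la by rewrite valK.
have /and3P[_ la0 /eqP sum_la] := partsP la.
have sz : size la <= n by rewrite -[leqRHS]sum_la size_le_sumn.
have -> : map val (intpart_pad la) = la ++ nseq (n - size la) 0.
  apply: (@eq_from_nth _ 0) => [|i].
    by rewrite size_map size_tuple size_cat size_nseq subnKC.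
  rewrite size_map size_tuple => lt_in.
  rewrite (nth_map ord0) ?size_tuple //.
  have -> : i = Ordinal lt_in by [].
  rewrite -tnth_nth tnth_mktuple /= inordK; last first.
    by rewrite ltnS -[leqRHS]sum_la nth_le_sumn.
  rewrite nth_cat nth_nseq; case: ltnP => // le_la.
  by rewrite nth_default //; case: ifP.
rewrite filter_cat filter_nseq /= cats0; apply/all_filterP/allP => x x_la.
by apply: contraNneq la0 => <-.
Qed.

End IntPartFinite.

HB.instance Definition _ n : isFinite (intpart n) :=
  PCanIsFinite (@intpart_padK n).

(* With 0-based indexing, the part lambda_i is nth 0 la i.-1, so that the    *)
(* weight i - 1 of lambda_i becomes its index.                               *)
Definition rs_bump (la : seq nat) : nat := \sum_(i < size la) i * nth 0 la i.

Local Open Scope ring_scope.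

Definition bump_poly (n : nat) : {poly int} :=
  \sum_(la : intpart n) 'X^(rs_bump la).

(* Formal power series in one variable t over R: F is determined by its      *)
(* coefficients [t^n] F = fpscoef F n.                                       *)
Record fps (R : comUnitRingType) := FPS { fpscoef : nat -> R }.

Section FPS.

Variable R : comUnitRingType.
Implicit Types F G H : fps R.

HB.instance Definition _ := gen_eqMixin (fps R).
HB.instance Definition _ := gen_choiceMixin (fps R).

Lemma fpsP F G : (forall n, fpscoef F n = fpscoef G n) <-> F = G.
Proof.
split=> [|-> //]; case: F G => [f] [g] /= eq_fg.
by congr FPS; apply/funext.
Qed.

Definition fpsC (c : R) : fps R := FPS (fun n => if n == 0%N then c else 0).
Definition fpsX : fps R := FPS (fun n => (n == 1%N)%:R).

Definition fps_add F G := FPS (fun n => fpscoef F n + fpscoef G n).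
Definition fps_opp F := FPS (fun n => - fpscoef F n).
Definition fps_mul F G :=
  FPS (fun n => \sum_(i < n.+1) fpscoef F i * fpscoef G (n - i)%N).

Lemma fps_addA : associative fps_add.
Proof. by move=> F G H; apply/fpsP => n /=; rewrite addrA. Qed.
Lemma fps_addC : commutative fps_add.
Proof. by move=> F G; apply/fpsP => n /=; rewrite addrC. Qed.
Lemma fps_add0 : left_id (fpsC 0) fps_add.
Proof. by move=> F; apply/fpsP => n /=; rewrite if_same add0r. Qed.
Lemma fps_addN : left_inverse (fpsC 0) fps_opp fps_add.
Proof. by move=> F; apply/fpsP => n /=; rewrite if_same addNr. Qed.

HB.instance Definition _ :=
  GRing.isZmodule.Build (fps R) fps_addA fps_addC fps_add0 fps_addN.

Definition fps_trunc m F : {poly R} := \poly_(i < m.+1) fpscoef F i.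

Lemma fps_mul_trunc m n F G : (n <= m)%N ->
  fpscoef (fps_mul F G) n = (fps_trunc m F * fps_trunc m G)`_n.
Proof.
move=> le_nm; rewrite coefM; apply: eq_bigr => i _; rewrite !coef_poly.
have le_in : (i <= n)%N by rewrite -ltnS.
by rewrite !ltnS (leq_trans le_in) // (leq_trans (leq_subr _ _)).
Qed.

Lemma fps_mulC : commutative fps_mul.
Proof. by move=> F G; apply/fpsP => n; rewrite !(@fps_mul_trunc n) // mulrC. Qed.

Lemma fps_mulA : associative fps_mul.
Proof.
have aux F G H n : fpscoef (fps_mul F (fps_mul G H)) n
    = (fps_trunc n F * (fps_trunc n G * fps_trunc n H))`_n.
  rewrite [LHS]/= coefM; apply: eq_bigr => i _.
  by rewrite coef_poly ltn_ord -fps_mul_trunc // leq_subr.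
move=> F G H; apply/fpsP => n.
by rewrite [in RHS]fps_mulC !aux mulrA mulrC.
Qed.

Lemma fps_mul1 : left_id (fpsC 1) fps_mul.
Proof.
move=> F; apply/fpsP => n /=; rewrite big_ord_recl /= subn0 mul1r.
by rewrite big1 ?addr0 // => i _; rewrite mul0r.
Qed.

Lemma fps_mulDl : left_distributive fps_mul fps_add.
Proof.
move=> F G H; apply/fpsP => n /=; rewrite -big_split /=.
by apply: eq_bigr => i _; rewrite mulrDl.
Qed.

Lemma fps1_neq0 : fpsC 1 != 0.
Proof.
by apply/eqP => /fpsP /(_ 0) /= /eqP; rewrite oner_eq0.
Qed.

HB.instance Definition _ := GRing.Zmodule_isComNzRing.Build (fps R)
  fps_mulA fps_mulC fps_mul1 fps_mulDl fps1_neq0.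

(* The first n + 1 coefficients g_0, ..., g_n of the inverse of F, given by  *)
(* g_0 = f_0^-1 and g_n = - f_0^-1 (f_1 g_(n-1) + ... + f_n g_0).            *)
Fixpoint fps_inv_seq F (n : nat) : seq R :=
  if n is m.+1 then
    let s := fps_inv_seq F m in
    rcons s (- (fpscoef F 0)^-1 *
               \sum_(i < m.+1) fpscoef F i.+1 * s`_(m - i))
  else [:: (fpscoef F 0)^-1].

Definition fps_unit : {pred fps R} :=
  fun F => fpscoef F 0 \is a GRing.unit.

Definition fps_inv F : fps R :=
  if fps_unit F then FPS (fun n => (fps_inv_seq F n)`_n) else F.

Lemma size_fps_inv_seq F n : size (fps_inv_seq F n) = n.+1.
Proof. by elim: n => //= n IHn; rewrite size_rcons IHn. Qed.

Lemma nth_fps_inv_seq F m n : (n <= m)%N ->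
  (fps_inv_seq F m)`_n = (fps_inv_seq F n)`_n.
Proof.
elim: m => [|m IHm]; first by rewrite leqn0 => /eqP->.
rewrite leq_eqVlt => /predU1P[-> //|lt_nm].
by rewrite /= nth_rcons size_fps_inv_seq lt_nm IHm.
Qed.

Lemma fps_mulVr : {in fps_unit, left_inverse 1 fps_inv *%R}.
Proof.
move=> F uF; rewrite mulrC; apply/fpsP => n.
have u0 : fpscoef F 0 \is a GRing.unit by [].
rewrite /fps_inv (_ : fps_unit F = true) //=.
case: n => [|n]; first by rewrite big_ord_recl big_ord0 addr0 /= mulrV.
rewrite big_ord_recl /= nth_rcons size_fps_inv_seq ltnn eqxx.
rewrite mulrA mulrN mulrV // mulN1r addrC; apply/eqP; rewrite subr_eq0.
apply/eqP/eq_bigr => i _; rewrite subSS.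
by rewrite [in RHS]nth_fps_inv_seq ?leq_subr.
Qed.

Lemma fps_unitPl F G : G * F = 1 -> fps_unit F.
Proof.
move=> /fpsP /(_ 0%N) /=; rewrite big_ord_recl big_ord0 addr0 /= => GF1.
by apply/unitrPr; exists (fpscoef G 0); rewrite mulrC; exact: GF1.
Qed.

Lemma fps_inv_out : {in [predC fps_unit], fps_inv =1 id}.
Proof.
by move=> F; rewrite inE /= /fps_inv; case: ifP => // uF; rewrite -topredE /= uF.
Qed.

HB.instance Definition _ := GRing.ComNzRing_hasMulInverse.Build (fps R)
  fps_mulVr fps_unitPl fps_inv_out.

End FPS.

Arguments fpsX {R}.

(* Main.v *)
Require Import Defs.
From mathcomp Require Import all_boot all_order all_algebra.

(** Let A_k(t) be the generating series, by size and with weight q^bump, of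
    the partitions with at most k parts ([bump_series k] below).  A partition
    with at most k+1 parts either has at most k parts, or has exactly k+1 parts
    and then is obtained in a unique way by adding 1 to each of the k+1 entries
    of a partition with at most k+1 parts, padded with zeros; this is the
    removal of a full first column from the Ferrers diagram.  Adding this
    column increases the size by k+1 and the bump statistic by
    0 + 1 + ... + k = C(k+1, 2), so that
      A_(k+1) = A_k + q^C(k+1, 2) t^(k+1) A_(k+1),
    which is [bump_series_rec].  Since A_0 = 1, the series A_k is the product
    of the 1 / (1 - q^C(i, 2) t^i) for 1 <= i <= k.  Finally, a partition of n
    has at most n parts, whence T_n(q) is the coefficient of t^n in A_n.

    The bijection is handled through the infinite sequence of parts
    i |-> [nth 0 la i], which determines a partition ([eq_from_nth0]) and on
    which adding a column is adding 1 to the first k+1 terms. *)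

Set Implicit Arguments.
Unset Strict Implicit.
Unset Printing Implicit Defensive.

Import GRing.Theory.

(** * Sequences of parts extended by zeros *)

Section ZeroExtension.

Implicit Types s : seq nat.

Lemma eq_from_nth0 s1 s2 : 0 \notin s1 -> 0 \notin s2 ->
  nth 0 s1 =1 nth 0 s2 -> s1 = s2.
Proof.
have le_size s s' : 0 \notin s -> nth 0 s =1 nth 0 s' -> size s <= size s'.
  move=> s0 eq_ss'; rewrite leqNgt; apply: contra s0 => lt_s's.
  by rewrite -(nth_default 0 (leqnn (size s'))) -eq_ss' mem_nth.
move=> s1_0 s2_0 eq12; apply: (@eq_from_nth _ 0) => [|i _]; last exact: eq12.
by apply/eqP; rewrite eqn_leq !le_size // => i; rewrite eq12.
Qed.

(** In a weakly decreasing sequence the zeros are at the end, so that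
    discarding them changes no entry of the extension. *)
Lemma nth_filter_neq0 s i : sorted geq s ->
  nth 0 [seq x <- s | x != 0] i = nth 0 s i.
Proof.
elim: s i => //= x s IHs i s_sorted; case: eqP => [x0 | _] /=; last first.
  by case: i => //= i; rewrite IHs ?(path_sorted s_sorted).
rewrite IHs ?(path_sorted s_sorted) // x0.
have geq_trans : transitive geq by move=> a b c ba ac; exact: leq_trans ac ba.
have s0 j : nth 0 s j = 0.
  case: (ltnP j (size s)) => [lt_js | /(nth_default 0)//].
  have /allP/(_ _ (mem_nth 0 lt_js)) := order_path_min geq_trans s_sorted.
  by rewrite x0 /= leqn0 => /eqP.
by case: i => [|i] /=; rewrite s0.
Qed.

Lemma sorted_geq_nth s i : sorted geq s -> nth 0 s i.+1 <= nth 0 s i.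
Proof.
move=> s_sorted; case: (ltnP i.+1 (size s)) => [lt_is | /(nth_default 0)-> //].
by move/(sortedP 0): s_sorted; apply.
Qed.

Lemma big_ord_nth0 (F : nat -> nat -> nat) k s :
  (forall i, F i 0 = 0) -> size s <= k ->
  \sum_(i < size s) F i (nth 0 s i) = \sum_(i < k) F i (nth 0 s i).
Proof.
move=> F0 le_sk; rewrite (big_ord_widen _ (fun i => F i (nth 0 s i)) le_sk).
rewrite big_mkcond; apply: eq_bigr => i _.
by case: ltnP => // le_si; rewrite nth_default.
Qed.

Lemma sumn_ord k s : size s <= k -> sumn s = \sum_(i < k) nth 0 s i.
Proof.
move=> le_sk; rewrite -(@big_ord_nth0 (fun=> id)) //.
by rewrite sumnE (big_nth 0) big_mkord.
Qed.

Lemma rs_bump_ord k s : size s <= k ->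
  rs_bump s = \sum_(i < k) i * nth 0 s i.
Proof. by move=> /(@big_ord_nth0 muln) <- // i; rewrite muln0. Qed.

End ZeroExtension.

(** * Adding and removing a full column *)

Section Column.

Implicit Types s : seq nat.

(** In terms of Ferrers diagrams: [add_column k] puts a column of height k in
    front of a diagram with at most k rows. *)
Definition add_column k s := mkseq (fun i => (nth 0 s i).+1) k.
Definition remove_column s := [seq x <- [seq x.-1 | x <- s] | x != 0].

Lemma size_remove_column s : size (remove_column s) <= size s.
Proof. by rewrite size_filter -[leqRHS](size_map predn) count_size. Qed.

Lemma remove_column_neq0 s : 0 \notin remove_column s.
Proof. by rewrite mem_filter. Qed.

Lemma add_column_neq0 k s : 0 \notin add_column k s.
Proof. by apply/mapP => -[]. Qed.

Lemma sorted_map_predn s : sorted geq s -> sorted geq [seq x.-1 | x <- s].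
Proof.
move=> s_sorted; apply: homo_sorted s_sorted => a b /= le_ba.
by rewrite -!subn1 leq_sub2r.
Qed.

Lemma sorted_remove_column s : sorted geq s -> sorted geq (remove_column s).
Proof.
move=> s_sorted; apply: sorted_filter => [a b c ba ac|].
  exact: leq_trans ac ba.
exact: sorted_map_predn.
Qed.

Lemma sorted_add_column k s : sorted geq s -> sorted geq (add_column k s).
Proof.
move=> s_sorted; apply/(sortedP 0) => i; rewrite size_mkseq => lt_ik.
by rewrite !nth_mkseq ?(ltnW lt_ik) //= ltnS sorted_geq_nth.
Qed.

Lemma nth_remove_column s i : sorted geq s ->
  nth 0 (remove_column s) i = (nth 0 s i).-1.
Proof.
move=> s_sorted; rewrite nth_filter_neq0; last first.
  exact: sorted_map_predn.
case: (ltnP i (size s)) => [lt_is | le_si]; first exact: nth_map.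
by rewrite !nth_default ?size_map.
Qed.

Lemma add_columnK k s : sorted geq s -> 0 \notin s -> size s <= k ->
  remove_column (add_column k s) = s.
Proof.
move=> s_sorted s0 le_sk; apply: eq_from_nth0 => // [|i].
  exact: remove_column_neq0.
rewrite nth_remove_column ?sorted_add_column //.
case: (ltnP i k) => [lt_ik | le_ki]; first by rewrite nth_mkseq.
by rewrite !nth_default ?size_mkseq // (leq_trans le_sk).
Qed.

Lemma remove_columnK s : sorted geq s -> 0 \notin s ->
  add_column (size s) (remove_column s) = s.
Proof.
move=> s_sorted s0; apply: (@eq_from_nth _ 0) => [|i].
  by rewrite size_mkseq.
rewrite size_mkseq => lt_is; rewrite nth_mkseq // nth_remove_column // prednK //.
by rewrite lt0n; apply: contraNneq s0 => <-; rewrite mem_nth.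
Qed.

Lemma sumn_add_column k s : size s <= k ->
  sumn (add_column k s) = k + sumn s.
Proof.
move=> le_sk; rewrite (sumn_ord le_sk) (@sumn_ord k) ?size_mkseq //.
under eq_bigr => i _ do rewrite nth_mkseq // -add1n.
by rewrite big_split /= sum1_card card_ord.
Qed.

(** The i-th entry, counted from 0, has weight i, so a column of height k
    contributes 0 + 1 + ... + (k - 1). *)
Lemma rs_bump_add_column k s : size s <= k ->
  rs_bump (add_column k s) = 'C(k, 2) + rs_bump s.
Proof.
move=> le_sk; rewrite (rs_bump_ord le_sk) (@rs_bump_ord k) ?size_mkseq //.
rewrite -triangular_sum big_mkord -big_split /=.
by apply: eq_bigr => i _; rewrite nth_mkseq // mulnS.
Qed.

Lemma is_intpart_add_column k n s : k <= n -> size s <= k ->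
  is_intpart (n - k) s -> is_intpart n (add_column k s).
Proof.
move=> le_kn le_sk /and3P[s_sorted _ /eqP sum_s]; apply/and3P; split.
- exact: sorted_add_column.
- exact: add_column_neq0.
- by rewrite sumn_add_column // sum_s subnKC.
Qed.

Lemma is_intpart_remove_column n s :
  is_intpart n s -> is_intpart (n - size s) (remove_column s).
Proof.
move=> /and3P[s_sorted s0 /eqP sum_s]; apply/and3P; split.
- exact: sorted_remove_column.
- exact: remove_column_neq0.
- rewrite -sum_s -[in sumn s](remove_columnK s_sorted s0).
  by rewrite sumn_add_column ?size_remove_column // addKn.
Qed.

Lemma is_intpart_ones n : is_intpart n (nseq n 1).
Proof.
apply/and3P; split; last by rewrite sumn_nseq mul1n.
  by case: n => //= n; elim: n.
by rewrite mem_nseq andbF.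
Qed.

Definition intpart_ones n : intpart n := IntPart (is_intpart_ones n).

(** The two maps below are meaningful only on partitions with at most k parts,
    when k <= n, and on partitions with exactly k parts, respectively;
    elsewhere they may take the arbitrary value [intpart_ones]. *)
Definition intpart_add_column k n (la : intpart (n - k)) : intpart n :=
  insubd (intpart_ones n) (add_column k la).

Definition intpart_remove_column k n (la : intpart n) : intpart (n - k) :=
  insubd (intpart_ones (n - k)) (remove_column la).

Lemma val_intpart_add_column k n (la : intpart (n - k)) :
  k <= n -> size la <= k ->
  intpart_add_column la = add_column k la :> seq nat.
Proof.
by move=> le_kn le_lak; apply/insubdK/is_intpart_add_column => //; exact: partsP.
Qed.

Lemma val_intpart_remove_column k n (la : intpart n) : size la = k ->
  intpart_remove_column k la = remove_column la :> seq nat.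
Proof.
by move=> <-; apply/insubdK/is_intpart_remove_column/partsP.
Qed.

Lemma size_intpart n (la : intpart n) : size la <= n.
Proof.
by have /and3P[_ la0 /eqP sum_la] := partsP la; rewrite -[leqRHS]sum_la size_le_sumn.
Qed.

End Column.

Local Open Scope ring_scope.

(** Removing the first column is a bijection from the partitions of n with
    exactly k parts to the partitions of n - k with at most k parts, and it
    lowers the bump statistic by C(k, 2). *)
Lemma sum_bump_size_eq k n : (k <= n)%N ->
  \sum_(la : intpart n | size la == k) 'X^(rs_bump la) =
  'X^('C(k, 2)) *
    \sum_(la : intpart (n - k) | (size la <= k)%N) 'X^(rs_bump la) :> {poly int}.
Proof.
move=> le_kn; rewrite mulr_sumr.
rewrite (reindex_onto (@intpart_add_column k n) (@intpart_remove_column k n)).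
  (* Reindexing requires the domain of column addition to be exactly the set
     of mu whose image has k parts and gives mu back when its column is removed,
     so arbitrary values of the two maps must not add any mu to it: if mu
     arises by removing a column from k parts, then it has at most k parts. *)
  have in_domain (mu : intpart (n - k)) :
      (size (intpart_add_column mu) == k) &&
      (intpart_remove_column k (intpart_add_column mu) == mu) =
      (size mu <= k)%N.
    apply/andP/idP => [[/eqP size_mu /eqP <-]|le_muk].
      by rewrite val_intpart_remove_column // -[leqRHS]size_mu size_remove_column.
    have size_k : size (intpart_add_column mu) = k.
      by rewrite val_intpart_add_column // size_mkseq.
    split; first exact/eqP.
    have /and3P[mu_sorted mu0 _] := partsP mu.
    rewrite -val_eqE /= val_intpart_remove_column // val_intpart_add_column //.
    by rewrite add_columnK.
  apply: eq_big => // mu; rewrite in_domain => le_muk.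
  by rewrite -exprD val_intpart_add_column // rs_bump_add_column.
move=> la /eqP size_la; have /and3P[la_sorted la0 _] := partsP la.
apply: val_inj; rewrite /= val_intpart_add_column //; last first.
  by rewrite val_intpart_remove_column // -[leqRHS]size_la size_remove_column.
by rewrite val_intpart_remove_column // -[in LHS]size_la remove_columnK.
Qed.

(** * Formal power series *)

Section Monomial.

Variable R : comUnitRingType.
Implicit Types (F : fps R) (c : R).

Lemma fpscoefX m n : fpscoef (fpsX ^+ m : fps R) n = (n == m)%:R.
Proof.
elim: m n => [|m IHm] n; first by rewrite expr0 /=; case: eqP.
rewrite exprS /=.
case: n => [|n]; first by rewrite big_ord_recl big_ord0 /= mul0r addr0.
rewrite !big_ord_recl /= mul0r add0r mul1r subSS subn0 IHm eqSS.
by rewrite big1 ?addr0 // => i _; rewrite mul0r.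
Qed.

Lemma fpscoef_monomial c m n :
  fpscoef (fpsC c * fpsX ^+ m) n = if n == m then c else 0.
Proof.
rewrite /= big_ord_recl /= big1 ?addr0 => [|i _]; last by rewrite mul0r.
by rewrite subn0 fpscoefX; case: eqP; rewrite ?mulr1 ?mulr0.
Qed.

Lemma fpscoef_monomialM c m F n :
  fpscoef (fpsC c * fpsX ^+ m * F) n =
  if (m <= n)%N then c * fpscoef F (n - m) else 0.
Proof.
have -> : fpscoef (fpsC c * fpsX ^+ m * F) n =
    \sum_(i < n.+1) (if i == m :> nat then c * fpscoef F (n - i) else 0).
  apply: eq_bigr => i _; rewrite fpscoef_monomial.
  by case: eqP; rewrite ?mul0r.
rewrite -big_mkcond; case: leqP => [le_mn | lt_nm].
  by rewrite (big_pred1 (Ordinal (le_mn : (m < n.+1)%N))).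
rewrite big_pred0 // => i; apply: contraTF lt_nm => /eqP <-.
by rewrite -leqNgt -ltnS.
Qed.

Lemma one_sub_monomial_unit c m :
  (0 < m)%N -> 1 - fpsC c * fpsX ^+ m \is a GRing.unit.
Proof.
move=> m_gt0; rewrite -topredE /= /fps_unit.
have -> : fpscoef (1 - fpsC c * fpsX ^+ m) 0 =
  1 - fpscoef (fpsC c * fpsX ^+ m) 0 by [].
by rewrite fpscoef_monomial ltn_eqF // subr0 unitr1.
Qed.

End Monomial.

(** * The product formula *)

Definition bump_series (k : nat) : fps {poly int} :=
  FPS (fun n => \sum_(la : intpart n | (size la <= k)%N) 'X^(rs_bump la)).

Lemma bump_series0 : bump_series 0 = 1.
Proof.
apply/fpsP => -[|n] /=.
  rewrite (big_pred1 (intpart_ones 0)) /=; first by rewrite /rs_bump big_ord0 expr0.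
  move=> la; have := size_intpart la; rewrite leqn0 => /eqP/size0nil la0.
  by rewrite la0; apply/esym/eqP/val_inj.
rewrite big_pred0 // => la; apply/negbTE; rewrite leqn0 size_eq0.
by apply: contraTneq (partsP la) => ->.
Qed.

(** Partitions with at most k+1 parts are sorted according to whether they have
    exactly k+1 parts; in that case their first column is removed. *)
Lemma bump_series_rec k :
  bump_series k.+1 =
  bump_series k + fpsC 'X^('C(k.+1, 2)) * fpsX ^+ k.+1 * bump_series k.+1.
Proof.
apply/fpsP => n.
have -> : fpscoef (bump_series k +
    fpsC 'X^('C(k.+1, 2)) * fpsX ^+ k.+1 * bump_series k.+1) n =
    fpscoef (bump_series k) n +
    fpscoef (fpsC 'X^('C(k.+1, 2)) * fpsX ^+ k.+1 * bump_series k.+1) n by [].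
rewrite fpscoef_monomialM /= (bigID (fun la : intpart n => size la <= k)%N) /=.
congr (_ + _).
  by apply: eq_bigl => la; apply: andb_idl => /leqW.
rewrite (eq_bigl (fun la : intpart n => size la == k.+1)) => [|la]; last first.
  by rewrite -ltnNge eqn_leq.
case: ltnP => [lt_kn | le_nk]; first exact: sum_bump_size_eq.
rewrite big_pred0 // => la; apply/negbTE; rewrite neq_ltn.
by rewrite (leq_ltn_trans (size_intpart la)) // ltnS.
Qed.

Lemma bump_seriesE k :
  bump_series k =
  \prod_(1 <= i < k.+1) (1 / (1 - fpsC 'X^('C(i, 2)) * fpsX ^+ i)).
Proof.
elim: k => [|k IHk]; first by rewrite big_geq // bump_series0.
rewrite big_nat_recr //= -IHk mul1r.
apply: (canRL (mulrK (one_sub_monomial_unit _ (ltn0Sn k)))).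
rewrite mulrBr mulr1 [X in _ - X]mulrC.
by rewrite [X in X - _]bump_series_rec addrK.
Qed.

Theorem theorem27 (n : nat) :
  bump_poly n =
  fpscoef (\prod_(1 <= i < n.+1)
             (1 / (1 - fpsC ('X^('C(i, 2)) : {poly int}) * fpsX ^+ i))) n.
Proof.
by rewrite -bump_seriesE; apply: eq_bigl => la; rewrite size_intpart.
Qed.
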